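(* Consider the set optimization problem $\preceq^{\ell}\text{-}\min_{x\in\mathbb{R}^n}F(x)$ with $F(x)=\{f^1(x),\dots,f^p(x)\}$. Let the iterates $x_k$ and search directions $d_k$, $k=0,1,2,\dots$, be generated by the Hager–Zhang conjugate gradient algorithm (described in the context) from a starting point $x_0$, and let $\mathcal{L}=\{x\in\mathbb{R}^n:F(x)\preceq^{\ell}F(x_0)\}$. Assume: (i) there are an open neighbourhood $\Gamma$ of $\mathcal{L}$ and $L>0$ such that $\|\nabla f^i(y)-\nabla f^i(z)\|\le L\|y-z\|$ for all $i\in[p]$ and $y,z\in\Gamma$; (ii) for every sequence $\{S_k\}_{k\ge0}$ of sets, each of the form $S_k=F(x)$ for some $x\in\mathcal{L}$, with $S_{k+1}\preceq^{\ell}S_k$ for all $k\ge0$, there is a bounded set $S\subseteq\mathbb{R}^m$ with $S\preceq^{\ell}S_k$ for all $k\ge0$. Then $$\sum_{k=0}^{\infty}\left\{\frac{\max_{j\in[\omega_k]}\phi\big(\nabla f^{a_{k,j}}(x_k)^{\top}d_k\big)}{\|d_k\|}\right\}^2<+\infty.$$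
   Context: $K\subset\mathbb{R}^m$ is a closed, convex, pointed cone with nonempty interior. For $U,V\subseteq\mathbb{R}^m$: $U\preceq^{\ell}V$ iff $V\subseteq U+K$, and $U\prec^{\ell}V$ iff $V\subseteq U+\mathrm{int}(K)$. The maps $f^1,\dots,f^p:\mathbb{R}^n\to\mathbb{R}^m$ are continuously differentiable. $[q]=\{1,\dots,q\}$. $\nabla f^j(x)^{\top}d\in\mathbb{R}^m$ denotes the derivative (Jacobian) of $f^j$ at $x$ applied to $d$. $\|\cdot\|$ is the Euclidean norm for vectors and the induced spectral norm for matrices; for a Jacobian difference viewed as a linear map $A:\mathbb{R}^n\to\mathbb{R}^m$, $\|A\|_{2,\infty}=\max\{\|Ax\|_\infty:\|x\|_2\le1\}$. Dual cone: $K^*=\{w: y^{\top}w\ge0\ \forall y\in K\}$. Fix $e\in\mathrm{int}(K)$; $C=\{w\in K^*: w^{\top}e=1\}$ (compact), $\phi(y)=\sup\{w^{\top}y: w\in C\}$. Minimal elements: $\mathrm{Min}(B,K)=\{y\in B: B\cap(y-K)=\{y\}\}$; $\omega(x)=|\mathrm{Min}(F(x),K)|$; enumerate $\mathrm{Min}(F(x),K)=\{v^x_1,\dots,v^x_{\omega(x)}\}$, let $I_v(x)=\{i\in[p]:f^i(x)=v\}$, and $P_x=\prod_{j=1}^{\omega(x)}I_{v^x_j}(x)$. Stationarity: $\bar x$ is stationary if for each $a\in P_{\bar x}$, $d\in\mathbb{R}^n$ there is $j\in[\omega(\bar x)]$ with $\nabla f^{a_j}(\bar x)^{\top}d\notin-\mathrm{int}(K)$;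 otherwise nonstationary. Algorithm. Parameters: $\rho\in(0,1)$, $\sigma\in(\rho,1)$, $\mu>\tfrac12$, $e\in\mathrm{int}(K)$, starting point $x_0\in\mathbb{R}^n$. At iteration $k=0,1,2,\dots$, with $\omega_k=\omega(x_k)$: (1) choose $(a_k,u_k)\in\operatorname{argmin}_{(a,u)\in P_{x_k}\times\mathbb{R}^n}\big(\max_{j\in[\omega_k]}\phi(\nabla f^{a_j}(x_k)^{\top}u)+\tfrac12\|u\|^2\big)$, where $a_k=(a_{k,1},\dots,a_{k,\omega_k})$; (2) set $d_0=u_0$ if $k=0$, and $d_k=u_k+\beta_kd_{k-1}$ if $k\ge1$, where $\beta_k=\max\{0,\beta^{\mathrm{HZ}}_k\}$, $$\beta^{\mathrm{HZ}}_k=\frac{1}{\mathcal{H}_2-\mathcal{H}_3}\Big\{\mathcal{H}_1-\frac{\mu\tilde{\mathcal{H}}_2}{\mathcal{H}_2-\mathcal{H}_3}\big\|\nabla f^{a_{k,j_{k-1}}}(x_k)-\nabla f^{a_{k,j_{k-1}}}(x_{k-1})\big\|_{2,\infty}^2\Big\},$$ $\mathcal{H}_1=\max_{j\in[\omega_k]}\phi(\nabla f^{a_{k,j}}(x_{k-1})^{\top}u_k)-\max_{j\in[\omega_k]}\phi(\nabla f^{a_{k,j}}(x_k)^{\top}u_k)$, $\mathcal{H}_2=\max_{j\in[\omega_{k-1}]}\phi(\nabla f^{a_{k-1,j}}(x_k)^{\top}d_{k-1})$, $\bar{\mathcal{H}}_2=\max_{j\in[\omega_k]}\phi(\nabla f^{a_{k,j}}(x_k)^{\top}d_{k-1})$,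 $\tilde{\mathcal{H}}_2=\max\{\mathcal{H}_2,\bar{\mathcal{H}}_2\}$, $\mathcal{H}_3=\max_{j\in[\omega_{k-1}]}\phi(\nabla f^{a_{k-1,j}}(x_{k-1})^{\top}d_{k-1})$, $j_{k-1}\in\operatorname{argmax}_{j\in[\omega_k]}\phi(\nabla f^{a_{k,j}}(x_{k-1})^{\top}u_k)$; (3) choose a step length $\alpha_k>0$ satisfying the standard Wolfe conditions $$F(x_k+\alpha_kd_k)\preceq^{\ell}\Big\{f^{a_{k,j}}(x_k)+\rho\alpha_k\Big(\max_{i\in[\omega_k]}\phi(\nabla f^{a_{k,i}}(x_k)^{\top}d_k)\Big)e\Big\}_{j\in[\omega_k]}\prec^{\ell}F(x_k),$$ $$\max_{j\in[\omega_k]}\phi(\nabla f^{a_{k,j}}(x_k+\alpha_kd_k)^{\top}d_k)\ge\sigma\max_{j\in[\omega_k]}\phi(\nabla f^{a_{k,j}}(x_k)^{\top}d_k);$$ (4) set $x_{k+1}=x_k+\alpha_kd_k$ and continue. Standing convention: the algorithm does not terminate, i.e. the sequence $\{x_k\}_{k\ge0}$ is infinite and consists of nonstationary points (equivalently $u_k\ne0$ for all $k$). *)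

(* Defs.v *)
From HB Require Import structures.
From mathcomp Require Import all_boot all_order all_algebra.
From mathcomp Require Import finmap.
From mathcomp Require Import all_classical all_reals all_analysis.

Set Implicit Arguments.
Unset Strict Implicit.
Unset Printing Implicit Defensive.

Import Order.TTheory GRing.Theory Num.Theory.
Import numFieldNormedType.Exports.

Local Open Scope classical_set_scope.
Local Open Scope ring_scope.

(* Vectors of R^n are row vectors.  The library's norm [`|v|] on ['rV[R]_n] is
   the maximum norm, so it serves as the infinity norm; the Euclidean norm is
   [enorm].  [jacobian] acts on row vectors from the right, so ['J f x] is the
   n x m matrix written \nabla f(x) and [d *m 'J f x] is \nabla f(x)^T d. *)

Section Euclidean.
Variable R : realType.

Definition dot m (y w : 'rV[R]_m) : R := \sum_i y 0 i * w 0 i.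

Definition enorm m (y : 'rV[R]_m) : R := Num.sqrt (dot y y).

(* The suprema of the next two definitions are attained. *)
Definition spectral_norm n m (A : 'M[R]_(n, m)) : R :=
  sup [set enorm (u *m A) | u in [set u : 'rV[R]_n | enorm u <= 1]].

Definition norm_2infty n m (A : 'M[R]_(n, m)) : R :=
  sup [set `|u *m A| | u in [set u : 'rV[R]_n | enorm u <= 1]].

(* The maximum of a finite family; it is meant for 0 < q, [sup] of the empty
   set being a dummy value. *)
Definition maxI q (g : 'I_q -> R) : R := sup (range g).

Definition C1 n m (f : 'rV[R]_n -> 'rV[R]_m) : Prop :=
  (forall x, differentiable f x) /\ continuous (jacobian f).

End Euclidean.

Section Cone.
Variables (R : realType) (m : nat) (K : set 'rV[R]_m).

Record solid_pointed_cone : Prop := SolidPointedCone {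
  cone_closed : closed K;
  cone_convex : convex_set K;
  cone_scale : forall (t : R) y, 0 <= t -> K y -> K (t *: y);
  cone_pointed : forall y, K y -> K (- y) -> y = 0;
  cone_solid : interior K !=set0 }.

Definition set_le (U V : set 'rV[R]_m) : Prop :=
  V `<=` [set y + z | y in U & z in K].

Definition set_lt (U V : set 'rV[R]_m) : Prop :=
  V `<=` [set y + z | y in U & z in interior K].

Definition dual_cone : set 'rV[R]_m :=
  [set w | forall y, K y -> 0 <= dot y w].

Definition dual_base (e : 'rV[R]_m) : set 'rV[R]_m :=
  [set w | dual_cone w /\ dot w e = 1].

Definition phi (e y : 'rV[R]_m) : R := sup [set dot w y | w in dual_base e].

Definition Min (B : set 'rV[R]_m) : set 'rV[R]_m :=
  [set y | B y /\ B `&` [set y - z | z in K] = [set y]].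

End Cone.

Section SetOptimization.
Variables (R : realType) (n m p : nat) (K : set 'rV[R]_m).
Variable f : 'I_p -> 'rV[R]_n -> 'rV[R]_m.

Definition F (x : 'rV[R]_n) : set 'rV[R]_m := range (fun i => f i x).

Definition omega (x : 'rV[R]_n) : nat := #|` fset_set (Min K (F x))|.

Definition enumerates_Min (v : forall x, 'I_(omega x) -> 'rV[R]_m) : Prop :=
  forall x, set_bij [set: 'I_(omega x)] (Min K (F x)) (v x).

Definition active (x : 'rV[R]_n) (y : 'rV[R]_m) : set 'I_p :=
  [set i | f i x = y].

Variable v : forall x, 'I_(omega x) -> 'rV[R]_m.
Arguments v : clear implicits.

Definition P (x : 'rV[R]_n) : set ('I_(omega x) -> 'I_p) :=
  [set a | forall j, active x (v x j) (a j)].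
Arguments P : clear implicits.

Definition stationary (x : 'rV[R]_n) : Prop :=
  forall a, P x a -> forall d : 'rV[R]_n,
  exists j, ~ [set - y | y in interior K] (d *m 'J (f (a j)) x).

Variable e : 'rV[R]_m.

Definition maxphi q (a : 'I_q -> 'I_p) (x d : 'rV[R]_n) : R :=
  maxI (fun j => phi K e (d *m 'J (f (a j)) x)).

Definition lower_level_set (x0 : 'rV[R]_n) : set 'rV[R]_n :=
  [set x | set_le K (F x) (F x0)].

Definition direction_argmin x (a : 'I_(omega x) -> 'I_p) (u : 'rV[R]_n) :=
  P x a /\
  forall a' u', P x a' ->
    maxphi a x u + enorm u ^+ 2 / 2 <= maxphi a' x u' + enorm u' ^+ 2 / 2.

(* [xp], [ap], [dp] are the iterate, indices and direction of iteration k - 1,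
   [x], [a], [u] the iterate, indices and minimiser of iteration k, and [j] is
   j_(k-1). *)
Definition beta_HZ (mu : R) qp q (xp x : 'rV[R]_n)
    (ap : 'I_qp -> 'I_p) (a : 'I_q -> 'I_p) (dp u : 'rV[R]_n) (j : 'I_q) : R :=
  let H1 := maxphi a xp u - maxphi a x u in
  let H2 := maxphi ap x dp in
  let H2bar := maxphi a x dp in
  let H2tilde := Num.max H2 H2bar in
  let H3 := maxphi ap xp dp in
  (H2 - H3)^-1 *
  (H1 - mu * H2tilde / (H2 - H3) *
        norm_2infty ('J (f (a j)) x - 'J (f (a j)) xp) ^+ 2).

Record wolfe (rho sigma : R) x (a : 'I_(omega x) -> 'I_p) (d : 'rV[R]_n)
    (alpha : R) : Prop := Wolfe {
  wolfe_pos : 0 < alpha;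
  wolfe_decrease :
    set_le K (F (x + alpha *: d))
      (range (fun j => f (a j) x + (rho * alpha * maxphi a x d) *: e));
  wolfe_strict :
    set_lt K (range (fun j => f (a j) x + (rho * alpha * maxphi a x d) *: e))
      (F x);
  wolfe_curvature : maxphi a (x + alpha *: d) d >= sigma * maxphi a x d }.

(* [j k] is j_k, an index of iteration k + 1. *)
Record HZ_sequence (rho sigma mu : R) (x0 : 'rV[R]_n)
    (x u d : nat -> 'rV[R]_n) (alpha : nat -> R)
    (a : forall k, 'I_(omega (x k)) -> 'I_p)
    (j : forall k, 'I_(omega (x k.+1))) : Prop := HZSequence {
  HZ_start : x 0%N = x0;
  HZ_nonstationary : forall k, ~ stationary (x k);
  HZ_argmin : forall k, direction_argmin (a k) (u k);
  HZ_argmax : forall k i,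
    phi K e (u k.+1 *m 'J (f (a k.+1 i)) (x k)) <=
    phi K e (u k.+1 *m 'J (f (a k.+1 (j k))) (x k));
  HZ_dir0 : d 0%N = u 0%N;
  HZ_dirS : forall k,
    d k.+1 = u k.+1 +
      Num.max 0 (beta_HZ mu (x k) (x k.+1) (a k) (a k.+1) (d k) (u k.+1) (j k))
        *: d k;
  HZ_wolfe : forall k, wolfe rho sigma (a k) (d k) (alpha k);
  HZ_step : forall k, x k.+1 = x k + alpha k *: d k }.

End SetOptimization.

(* Main.v *)
(** Write [M_k] for [maxphi] at [x_k] along [d_k].  The strict part of the
    decrease condition forces [M_k < 0]: otherwise a minimal element of
    [F(x_k)] would lie in [y + int K] for some [y] in [F(x_k)].  The function
    [phi] is Lipschitz because [e] is interior to [K], so the curvature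
    condition and the Lipschitz Jacobians give
    [(1 - sigma) (- M_k) <= c L alpha_k |d_k|^2], that is
    [(M_k / |d_k|)^2 <= c L / (1 - sigma) * (- alpha_k M_k)].  Telescoping the
    decrease condition yields
    [F(x_N) <= F(x_0) + rho (\sum_(k < N) alpha_k M_k) e] for the lower set
    order; testing against one [w] in [C] and using the bounded lower bound of
    the [F(x_k)] bounds the partial sums of [- alpha_k M_k]. *)
Require Import Defs.
From HB Require Import structures.
From mathcomp Require Import all_boot all_order all_algebra.
From mathcomp Require Import all_classical all_reals all_analysis.
From mathcomp Require Import lra ring.

Set Implicit Arguments.
Unset Strict Implicit.
Unset Printing Implicit Defensive.

Import Order.TTheory GRing.Theory Num.Theory.
Import numFieldNormedType.Exports.

Local Open Scope classical_set_scope.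
Local Open Scope ring_scope.

(** * Euclidean norm and spectral norm *)

Section Euclidean_norm.
Variable R : realType.
Implicit Types m n : nat.

Lemma dotC m (y w : 'rV[R]_m) : dot y w = dot w y.
Proof. by apply: eq_bigr => i _; rewrite mulrC. Qed.

Lemma dotDl m (y z w : 'rV[R]_m) : dot (y + z) w = dot y w + dot z w.
Proof. by rewrite -big_split; apply: eq_bigr => i _; rewrite mxE mulrDl. Qed.

Lemma dotZl m t (y w : 'rV[R]_m) : dot (t *: y) w = t * dot y w.
Proof. by rewrite mulr_sumr; apply: eq_bigr => i _; rewrite mxE mulrA. Qed.

Lemma dotNl m (y w : 'rV[R]_m) : dot (- y) w = - dot y w.
Proof. by rewrite -scaleN1r dotZl mulN1r. Qed.

Lemma dotDr m (y z w : 'rV[R]_m) : dot w (y + z) = dot w y + dot w z.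
Proof. by rewrite ![dot w _]dotC dotDl. Qed.

Lemma dot_ge0 m (y : 'rV[R]_m) : 0 <= dot y y.
Proof. by apply: sumr_ge0 => i _; rewrite -expr2 sqr_ge0. Qed.

Lemma enorm_ge0 m (y : 'rV[R]_m) : 0 <= enorm y.
Proof. exact: sqrtr_ge0. Qed.

Lemma enorm0 m : enorm (0 : 'rV[R]_m) = 0.
Proof. by rewrite /enorm /dot big1 ?sqrtr0 // => i _; rewrite mxE mul0r. Qed.

Lemma enormZ m t (y : 'rV[R]_m) : enorm (t *: y) = `|t| * enorm y.
Proof.
by rewrite /enorm dotZl dotC dotZl mulrA -expr2 sqrtrM ?sqr_ge0 // sqrtr_sqr.
Qed.

Lemma coord_le_enorm m (y : 'rV[R]_m) i : `|y 0 i| <= enorm y.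
Proof.
rewrite -sqrtr_sqr ler_sqrt ?dot_ge0 // /dot (bigD1 i) //= -expr2 lerDl.
by apply: sumr_ge0 => l _; rewrite -expr2 sqr_ge0.
Qed.

Lemma norm_le_enorm m (y : 'rV[R]_m) : `|y| <= enorm y.
Proof.
rewrite [`|y|]/Num.norm /= mx_normrE; apply/bigmax_leP.
split; first exact: enorm_ge0.
by case=> i l _ /=; rewrite (ord1 i) coord_le_enorm.
Qed.

Lemma enorm_gt0 m (y : 'rV[R]_m) : y != 0 -> 0 < enorm y.
Proof.
by move=> y0; apply: lt_le_trans (norm_le_enorm y); rewrite normr_gt0.
Qed.

Lemma enorm_le_sum m (y : 'rV[R]_m) : enorm y <= \sum_i `|y 0 i|.
Proof.
have s0 : 0 <= \sum_i `|y 0 i| by apply: sumr_ge0.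
rewrite -[leRHS]ger0_norm // -sqrtr_sqr ler_sqrt ?sqr_ge0 // expr2 mulr_suml.
apply: ler_sum => i _; rewrite -expr2 -real_normK ?num_real //.
by rewrite expr2 ler_wpM2l // (bigD1 i) //= lerDl sumr_ge0.
Qed.

(** The set under the supremum is bounded because a vector of the unit ball has entries of modulus
    at most 1; normalising [u] then gives the estimate. *)
Lemma enorm_mulmx_le n m (A : 'M[R]_(n, m)) (u : 'rV[R]_n) :
  enorm (u *m A) <= spectral_norm A * enorm u.
Proof.
have ub : has_ubound
    [set enorm (u *m A) | u in [set u : 'rV[R]_n | enorm u <= 1]].
  exists (\sum_l \sum_i `|A i l|) => _ [w /= w1 <-].
  apply: le_trans (enorm_le_sum _) _; apply: ler_sum => l _; rewrite mxE.
  apply: le_trans (ler_norm_sum _ _ _) _; apply: ler_sum => i _.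
  by rewrite normrM ler_piMl // (le_trans (coord_le_enorm w i)).
have [->|u0] := eqVneq u 0; first by rewrite mul0mx !enorm0 mulr0.
have u_gt0 := enorm_gt0 u0.
rewrite -ler_pdivrMr // mulrC -[X in X * _]ger0_norm ?invr_ge0 ?enorm_ge0 //.
rewrite -enormZ scalemxAl; apply: (ub_le_sup ub).
exists ((enorm u)^-1 *: u) => //=.
by rewrite enormZ ger0_norm ?invr_ge0 ?enorm_ge0 // mulVf // gt_eqF.
Qed.

End Euclidean_norm.

(** * Finite maxima *)

Lemma maxI_ge (R : realType) q (g : 'I_q -> R) i : g i <= maxI g.
Proof.
apply: ub_le_sup; last by exists i.
exists (\sum_l `|g l|) => _ [l _ <-]; apply: le_trans (ler_norm _) _.
by rewrite (bigD1 l) //= lerDl sumr_ge0.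
Qed.

Lemma maxI_le (R : realType) q (g : 'I_q -> R) c :
  (0 < q)%N -> (forall i, g i <= c) -> maxI g <= c.
Proof.
move=> q0 gc; apply: ge_sup => [|_ [i _ <-]]; last exact: gc.
by exists (g (Ordinal q0)); exists (Ordinal q0).
Qed.

(** * The ordering cone and the lower set order *)

Section Ordering_cone.
Variables (R : realType) (m : nat) (K : set 'rV[R]_m).
Hypothesis coneK : solid_pointed_cone K.
Implicit Types (y z w e : 'rV[R]_m) (U V W : set 'rV[R]_m).

Lemma coneD y z : K y -> K z -> K (y + z).
Proof.
move=> Ky Kz; have h : 0 <= (2^-1 : R) by [].
have h01 : 0 <= (2^-1 : R) <= 1 by rewrite h invf_le1 ?ler1n.
(* Convexity yields the midpoint of [y] and [z]; scaling by 2 turns it into the sum. *)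
have := cone_convex coneK (Itv01 h (andP h01).2) (mem_set Ky) (mem_set Kz).
rewrite inE => /(cone_scale coneK (ler0n R 2)) /=.
rewrite /conv /= /unstable.onem.
have -> : 1 - 2^-1 = 2^-1 :> R by lra.
by rewrite -scalerDr scalerA divff ?scale1r // pnatr_eq0.
Qed.

Lemma cone0 : K 0.
Proof.
have [y /interior_subset Ky] := cone_solid coneK.
by rewrite -(scale0r y); apply: cone_scale coneK _ _ _ Ky.
Qed.

(** A ball around 0 inside [K] would contain a nonzero constant vector together with its opposite,
    against pointedness. *)
Lemma interior_cone_neq0 z : (0 < m)%N -> interior K z -> z != 0.
Proof.
move=> m0 Kz; apply/eqP => z0; move: Kz; rewrite {}z0 => /nbhs_ballP[r /= r0 rK].
pose y : 'rV[R]_m := const_mx (r / 2).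
have y_norm : `|y| < r.
  apply: le_lt_trans (_ : r / 2 < r); last first.
    by rewrite ltr_pdivrMr // ltr_pMr // ltr1n.
  rewrite [`|y|]/Num.norm /= mx_normrE; apply/bigmax_leP; split=> [|i _].
    by rewrite ltW // divr_gt0.
  by rewrite mxE ger0_norm // ltW // divr_gt0.
have Ky : K y by apply: rK; rewrite -ball_normE /= sub0r normrN.
have KNy : K (- y) by apply: rK; rewrite -ball_normE /= opprK add0r.
have /rowP/(_ (Ordinal m0)) := cone_pointed coneK Ky KNy.
by rewrite !mxE => /eqP; rewrite mulf_eq0 invr_eq0 pnatr_eq0 orbF gt_eqF.
Qed.

Lemma set_le_trans V U W : set_le K U V -> set_le K V W -> set_le K U W.
Proof.
move=> UV VW w /VW[y /UV[s Us [z Kz <-]] [z' Kz' <-]].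
by exists s => //; exists (z + z'); rewrite ?addrA //; apply: coneD.
Qed.

Lemma set_ltW U V : set_lt K U V -> set_le K U V.
Proof.
by move=> UV y /UV[s Us [z /interior_subset Kz <-]]; exists s => //; exists z.
Qed.

Lemma set_le_shift U V y :
  set_le K U V -> set_le K [set s + y | s in U] [set s + y | s in V].
Proof.
move=> UV _ [_ /UV[s Us [z Kz <-]] <-]; exists (s + y); first by exists s.
by exists z; rewrite // addrAC.
Qed.

(** If [K] contains the ball of radius [r] around [e], it contains [e - t *: y] whenever [t *: y]
    has norm [r / 2]. Pairing with [w] gives [t * dot w y <= 1], so [2 / r] works for all [w] at
    once. *)
Lemma dual_base_bound e : interior K e ->
  exists2 c : R, 0 < c &
    forall w, dual_base K e w -> forall y, dot w y <= c * `|y|.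
Proof.
move=> /nbhs_ballP[r /= r0 rK]; exists (2 / r) => [|w [wK we] y].
  by rewrite divr_gt0.
have [->|y0] := eqVneq y 0.
  by rewrite normr0 mulr0 dotC -(scale0r 0) dotZl mul0r.
have y_gt0 : 0 < `|y| by rewrite normr_gt0.
pose t := r / (2 * `|y|).
have t0 : 0 < t by rewrite divr_gt0 // mulr_gt0.
have /wK : K (e - t *: y).
  apply: rK; rewrite -ball_normE /= opprB addrC subrK normrZ gtr0_norm //.
  have -> : t * `|y| = r / 2 by rewrite /t; field; rewrite gt_eqF.
  by rewrite ltr_pdivrMr // ltr_pMr // ltr1n.
rewrite dotDl dotNl dotZl dotC we (dotC y) subr_ge0 -ler_pdivlMl // mulr1.
by rewrite /t invf_div mulrAC.
Qed.

(** * Lipschitz estimates for the scalarization *)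

Section Scalarization.
Variables (e : 'rV[R]_m) (c : R).
Hypothesis c_bound : forall w, dual_base K e w -> forall y, dot w y <= c * `|y|.
Hypothesis base_neq0 : dual_base K e !=set0.

Lemma phi_le_add y z : phi K e y <= phi K e z + c * `|y - z|.
Proof.
have [w0 Cw0] := base_neq0.
apply: ge_sup => [|_ [w Cw <-]]; first by exists (dot w0 y); exists w0.
rewrite -{1}(subrKC z y) dotDr lerD ?c_bound //.
apply: ub_le_sup; last by exists w.
by exists (c * `|z|) => _ [w' Cw' <-]; exact: c_bound.
Qed.

Lemma maxphi_le_add n p (f : 'I_p -> 'rV[R]_n -> 'rV[R]_m) q
    (a : 'I_q -> 'I_p) (x y d : 'rV[R]_n) b : (0 < q)%N -> 0 <= c ->
  (forall i, `|d *m ('J (f i) y - 'J (f i) x)| <= b) ->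
  maxphi K f e a y d <= maxphi K f e a x d + c * b.
Proof.
move=> q0 c0 hb; apply: maxI_le => // i.
apply: le_trans (phi_le_add _ (d *m 'J (f (a i)) x)) _; apply: lerD.
  exact: (maxI_ge (fun j => phi K e (d *m 'J (f (a j)) x))).
by rewrite -mulmxBr ler_wpM2l.
Qed.

End Scalarization.

(** Over an empty base [phi] is the default value 0 of [sup], so a negative maximum exhibits an
    element of the base without any separation argument. *)
Lemma maxphi_neg_base_neq0 n p (f : 'I_p -> 'rV[R]_n -> 'rV[R]_m) q
    (a : 'I_q -> 'I_p) e x d :
  (0 < q)%N -> maxphi K f e a x d < 0 -> dual_base K e !=set0.
Proof.
move=> q0; rewrite ltNge => /negP M0; apply: contrapT => C0; apply: M0.
apply: le_trans (maxI_ge _ (Ordinal q0)); rewrite /phi.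
have -> : dual_base K e = set0.
  by apply/seteqP; split => // w Cw; apply: C0; exists w.
by rewrite image_set0 sup0.
Qed.

(** * Domination by minimal elements *)

Section Minimal_elements.
Variables (n p : nat) (f : 'I_p -> 'rV[R]_n -> 'rV[R]_m).

(** Among the indices whose value lies below that of [i0], one with the fewest indices below it has
    a minimal value. *)
Lemma Min_le x : set_le K (Min K (F f x)) (F f x).
Proof.
move=> _ [i0 _ <-].
pose below i := [pred i' | `[<K (f i x - f i' x)>]].
have below_refl i : below i i by apply/asboolP; rewrite subrr; exact: cone0.
have [i /asboolP Ki imin] :=
  arg_minnP (fun i => #|below i|) (below_refl i0).
exists (f i x); last by exists (f i0 x - f i x); rewrite // subrKC.
split; first by exists i.
apply/seteqP; split => [_ [[i' _ <-] [z Kz zE]]|_ ->]; last first.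
  by split; [exists i | exists 0; rewrite ?subr0 //; exact: cone0].
have Kii' : K (f i x - f i' x) by rewrite -zE opprB subrKC.
have sub : below i' \subset below i.
  apply/fintype.subsetP => l /asboolP Kl; apply/asboolP.
  by rewrite -(subrKA (f i' x)); apply: coneD.
have /imin card_le : below i0 i'.
  by apply/asboolP; rewrite -(subrKA (f i x)); apply: coneD.
(* By the choice of [i] the inclusion is an equality, so [i] is itself below [i'], and pointedness
   identifies the two values. *)
have /geq_leqif := subset_leqif_card sub.
rewrite card_le => /esym/fintype.subsetP/(_ _ (below_refl i))/asboolP Ki'i.
apply/eqP; rewrite -subr_eq0; apply/eqP/(cone_pointed coneK) => //.
by rewrite opprB.
Qed.

End Minimal_elements.
End Ordering_cone.

(** * Consequences of a single Wolfe step *)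

Section Wolfe_step.
Variables (R : realType) (n m p : nat) (K : set 'rV[R]_m).
Hypotheses (coneK : solid_pointed_cone K) (m_gt0 : (0 < m)%N).
Variable f : 'I_p -> 'rV[R]_n -> 'rV[R]_m.
Variable v : forall x : 'rV[R]_n, 'I_(omega K f x) -> 'rV[R]_m.
Hypotheses (v_enum : enumerates_Min v) (p_gt0 : (0 < p)%N).
Variables (x : 'rV[R]_n) (a : 'I_(omega K f x) -> 'I_p).
Hypothesis Pa : P v a.

(** The selected maps attain every minimal value, and these dominate [F f x]. *)
Lemma selection_le : set_le K (range (fun j => f (a j) x)) (F f x).
Proof.
move=> y /(Min_le coneK)[s sMin sy]; exists s => //.
have [_ _ /(_ _ sMin)[j _ <-]] := v_enum x.
by exists j => //; exact: Pa.
Qed.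

Lemma omega_gt0 : (0 < omega K f x)%N.
Proof.
have [|_ [j _ _] _] := @selection_le (f (Ordinal p_gt0) x).
  by exists (Ordinal p_gt0).
exact: leq_ltn_trans (ltn_ord j).
Qed.

Variables (e : 'rV[R]_m) (rho sigma : R) (d : 'rV[R]_n) (alpha : R).
Hypotheses (e_int : interior K e) (rho_gt0 : 0 < rho).
Hypothesis W : wolfe e rho sigma a d alpha.

Let M := maxphi K f e a x d.

Lemma wolfe_descent : M < 0.
Proof.
rewrite ltNge; apply/negP => M0.
have j0 : 'I_(omega K f x) := Ordinal omega_gt0.
have [y_F /seteqP[y_min _]] : Min K (F f x) (f (a j0) x).
  by rewrite (Pa j0); have [+ _ _] := v_enum x; apply.
(* The minimal value equals [f (a j) x] plus a nonnegative multiple of [e] plus an interior [z].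
   Minimality makes the two values equal, so [- z] is that multiple of [e] and lies in [K], which
   forces [z = 0]. *)
have [_ [j _ <-] [z z_int zE]] := wolfe_strict W y_F.
have Kte : K ((rho * alpha * M) *: e).
  apply: cone_scale coneK _ _ _ (interior_subset e_int).
  by rewrite mulr_ge0 // mulr_ge0 // ltW // (wolfe_pos W).
have yE : f (a j) x = f (a j0) x.
  apply: y_min; split; first by exists (a j).
  exists ((rho * alpha * M) *: e + z).
    by apply: coneD => //; exact: interior_subset.
  by rewrite -zE -[X in X - _]addrA addrK.
have /(cone_pointed coneK (interior_subset z_int)) : K (- z).
  move: zE; rewrite yE -addrA -[RHS]addr0 => /addrI/eqP.
  by rewrite addr_eq0 => /eqP <-.
by apply/eqP; exact: interior_cone_neq0 z_int.
Qed.

Lemma wolfe_set_le : set_le K (F f (x + alpha *: d)) (F f x).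
Proof.
exact: set_le_trans coneK _ _ _ (wolfe_decrease W) (set_ltW (wolfe_strict W)).
Qed.

(** Stating the decrease against all of [F f x] rather than the selected values lets successive
    steps be chained. *)
Lemma wolfe_set_le_shift :
  set_le K (F f (x + alpha *: d)) [set y + (rho * alpha * M) *: e | y in F f x].
Proof.
pose shifted := set_le_shift (y := (rho * alpha * M) *: e) selection_le.
apply: (set_le_trans coneK _ shifted).
by move=> _ [_ [j _ <-] <-]; apply: (wolfe_decrease W); exists j.
Qed.

Lemma wolfe_step_bound (Gamma : set 'rV[R]_n) (L c : R) :
  sigma < 1 -> 0 <= L -> 0 < c ->
  (forall w, dual_base K e w -> forall y, dot w y <= c * `|y|) ->
  (forall i y z, Gamma y -> Gamma z ->
     spectral_norm ('J (f i) y - 'J (f i) z) <= L * enorm (y - z)) ->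
  Gamma x -> Gamma (x + alpha *: d) ->
  (M / enorm d) ^+ 2 <= c * L / (1 - sigma) * - (alpha * M).
Proof.
move=> sigma1 L0 c0 cb lip Gx Gy; have M0 := wolfe_descent.
have a0 := wolfe_pos W.
have d0 : d != 0.
  (* For [d = 0] the curvature condition reads [sigma * M <= M], impossible with [M < 0] and
     [sigma < 1]. *)
  apply/eqP => d0; have := wolfe_curvature W.
  rewrite [in _ + _]d0 scaler0 addr0 -/M -/M; nra.
have dn0 : 0 < enorm d := enorm_gt0 d0.
have curv : (1 - sigma) * - M <= c * (L * alpha * enorm d ^+ 2).
  have diff i : `|d *m ('J (f i) (x + alpha *: d) - 'J (f i) x)| <=
      L * alpha * enorm d ^+ 2.
    apply: le_trans (norm_le_enorm _) _; apply: le_trans (enorm_mulmx_le _ _) _.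
    rewrite expr2 mulrA ler_wpM2r ?enorm_ge0 //.
    apply: le_trans (lip _ _ _ Gy Gx) _.
    by rewrite addrC addKr enormZ gtr0_norm // mulrA.
  have := maxphi_le_add cb (maxphi_neg_base_neq0 omega_gt0 M0) a
    omega_gt0 (ltW c0) diff.
  have := wolfe_curvature W; rewrite -/M; lra.
have s1 : 0 < 1 - sigma by rewrite subr_gt0.
(* The claim is [curv] multiplied by [- M] and divided by [(1 - sigma) * enorm d ^+ 2]. *)
have -> : c * L / (1 - sigma) * - (alpha * M) =
    (- M) * (c * (L * alpha * enorm d ^+ 2)) / ((1 - sigma) * enorm d ^+ 2).
  by field; rewrite !gt_eqF.
rewrite ler_pdivlMr ?mulr_gt0 ?exprn_gt0 //.
have -> : (M / enorm d) ^+ 2 * ((1 - sigma) * enorm d ^+ 2) =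
    (- M) * ((1 - sigma) * - M) by field; rewrite gt_eqF.
by rewrite ler_wpM2l // oppr_ge0 ltW.
Qed.

End Wolfe_step.

(** * Summation along the iterates *)

Theorem theorem4p2 (R : realType) (n m p : nat)
  (m_gt0 : (0 < m)%N) (p_gt0 : (0 < p)%N)
  (K : set 'rV[R]_m) (coneK : solid_pointed_cone K)
  (f : 'I_p -> 'rV[R]_n -> 'rV[R]_m) (f_C1 : forall i, C1 (f i))
  (v : forall x : 'rV[R]_n, 'I_(omega K f x) -> 'rV[R]_m)
  (v_enum : enumerates_Min v)
  (e : 'rV[R]_m) (e_int : interior K e)
  (rho sigma mu : R) (rho01 : 0 < rho < 1) (sigma01 : rho < sigma < 1)
  (mu_gt : 1 / 2 < mu)
  (x0 : 'rV[R]_n) (x u d : nat -> 'rV[R]_n) (alpha : nat -> R)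
  (a : forall k, 'I_(omega K f (x k)) -> 'I_p)
  (j : forall k, 'I_(omega K f (x k.+1)))
  (HZ : HZ_sequence v e rho sigma mu x0 u d alpha a j)
  (lipschitz : exists (Gamma : set 'rV[R]_n) (L : R),
     [/\ open Gamma, lower_level_set K f x0 `<=` Gamma, 0 < L &
         forall i y z, Gamma y -> Gamma z ->
           spectral_norm ('J (f i) y - 'J (f i) z) <= L * enorm (y - z)])
  (bounded_below : forall S : nat -> set 'rV[R]_m,
     (forall k, exists2 y, lower_level_set K f x0 y & S k = F f y) ->
     (forall k, set_le K (S k.+1) (S k)) ->
     exists2 S0 : set 'rV[R]_m,
       bounded_set S0 & forall k, set_le K S0 (S k)) :
  (\sum_(0 <= k <oo)
     (((maxphi K f e (a k) (x k) (d k)) / enorm (d k)) ^+ 2)%:E < +oo)%E.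
Proof.
have [x_start _ argmin _ _ _ W step] := HZ.
have [/andP[rho0 _] /andP[_ sigma1]] := (rho01, sigma01).
have [Gamma [L [_ levelG L0 lip]]] := lipschitz.
have Pa k : P v (a k) := (argmin k).1.
pose M k := maxphi K f e (a k) (x k) (d k).
have M0 k : M k < 0 :=
  wolfe_descent coneK m_gt0 v_enum p_gt0 (Pa k) e_int rho0 (W k).
have decr k : set_le K (F f (x k.+1)) (F f (x k)).
  by rewrite step; exact: (wolfe_set_le coneK (W k)).
have level k : lower_level_set K f x0 (x k).
  elim: k => [|k IH]; last first.
    by apply: (set_le_trans coneK) IH; exact: decr.
  rewrite x_start => y Fy; exists y => //.
  by exists 0; rewrite ?addr0 //; exact: (cone0 coneK).
have [|//|S0 [B [_ S0_bnd]] S0_le] := bounded_below (fun k => F f (x k)).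
  by move=> k; exists (x k).
have [c c0 cb] := dual_base_bound e_int.
have [w Cw] :=
  maxphi_neg_base_neq0 (omega_gt0 coneK v_enum p_gt0 (Pa 0%N)) (M0 0%N).
pose T N := \sum_(0 <= k < N) alpha k * M k.
have telescope N : set_le K (F f (x N))
    [set y + (rho * T N) *: e | y in F f (x 0%N)].
  elim: N => [|N IH].
    move=> _ [y Fy <-]; exists y => //; exists 0; first exact: (cone0 coneK).
    by rewrite /T big_geq // mulr0 scale0r.
  have h : set_le K (F f (x N.+1))
      [set y + (rho * alpha N * M N) *: e | y in F f (x N)].
    by rewrite step; exact: (wolfe_set_le_shift coneK v_enum (Pa N) (W N)).
  apply: (set_le_trans coneK h) => _ [y Fy <-].
  have := set_le_shift (y := (rho * alpha N * M N) *: e) IH.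
  move=> /(_ (y + (rho * T N.+1) *: e)); apply.
  exists (y + (rho * T N) *: e); first by exists y.
  by rewrite -addrA -scalerDl /T big_nat_recr //= mulrDr mulrA.
pose y0 := f (Ordinal p_gt0) (x 0%N).
(* [S0_bnd] bounds [S0] by any number strictly above [B], whose sign is unknown. *)
pose b := `|B| + 1.
have T_lb N : - (c * b) - dot w y0 <= rho * T N.
  have S0T : set_le K S0 [set y + (rho * T N) *: e | y in F f (x 0%N)].
    by apply: (set_le_trans coneK) (S0_le N) _; exact: telescope.
  have [|s S0s [z Kz zE]] := S0T (y0 + (rho * T N) *: e).
    by exists y0 => //; exists (Ordinal p_gt0).
  have s_bnd : `|s| <= b.
    by apply: S0_bnd S0s; rewrite (le_lt_trans (ler_norm B)) // ltrDl.
  (* Pair [s + z = y0 + (rho * T N) *: e] with [w]: here [dot w e = 1], [dot w z] is nonnegative and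
     [dot w s] is at least [- (c * b)]. *)
  have := cb _ Cw (- s); rewrite normrN => ws.
  have wz : 0 <= dot w z by rewrite dotC; exact: Cw.1.
  have := congr1 (dot w) zE.
  rewrite !dotDr [dot w (_ *: e)]dotC dotZl (dotC e) Cw.2.
  have : dot w (- s) = - dot w s by rewrite dotC dotNl dotC.
  nra.
pose D := c * L / (1 - sigma).
have D0 : 0 <= D by rewrite !mulr_ge0 ?invr_ge0 ?subr_ge0 // ltW.
apply: (le_lt_trans _ (ltry (D * ((c * b + dot w y0) / rho)))).
(* The terms are nonnegative, so the series converges in the extended reals and a uniform bound on
   its partial sums suffices. *)
apply: lime_le.
  by apply: is_cvg_nneseries => k _ _; rewrite lee_fin sqr_ge0.
near=> N; rewrite sumEFin lee_fin.
apply: (@le_trans _ _ (D * - T N)).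
  rewrite /T -sumrN mulr_sumr; apply: ler_sum => k _.
  apply: (wolfe_step_bound coneK m_gt0 v_enum p_gt0 (Pa k) e_int rho0 (W k)
    sigma1 (ltW L0) c0 cb lip (levelG _ (level k))).
  by rewrite -step; exact/levelG/level.
by rewrite ler_wpM2l // ler_pdivlMr // mulrC; have := T_lb N; lra.
Unshelve. all: by end_near.
Qed.
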